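(* Let $R=\{(1,0),(1,1),(2,0),(2,1),(2,3),(3,0),(3,1),(3,3)\}$ and let $\mathrm{P}_7=(123,R)$ and $\mathrm{P}_8=(132,R)$ be mesh patterns. For every $n\ge 1$ and all integers $k,\ell\ge 0$, $$|\{\sigma\in\mathfrak{S}_n: \mathrm{P}_7(\sigma)=k,\ \mathrm{P}_8(\sigma)=\ell\}| = |\{\sigma\in\mathfrak{S}_n: \mathrm{P}_8(\sigma)=k,\ \mathrm{P}_7(\sigma)=\ell\}|.$$
   Context: $\mathfrak{S}_n$ is the set of permutations $\sigma=\sigma_1\sigma_2\cdots\sigma_n$ of $[n]=\{1,\dots,n\}$ in one-line notation. A mesh pattern is a pair $p=(\pi,R)$ with $\pi\in\mathfrak{S}_m$ and $R\subseteq\{0,\dots,m\}\times\{0,\dots,m\}$ (the set of shaded unit cells, each given by its bottom-left corner, in the grid with dots at $(i,\pi_i)$). An occurrence of $p$ in $\sigma\in\mathfrak{S}_n$ is a choice of indices $i_1<\cdots<i_m$ such that $\sigma_{i_1}\cdots\sigma_{i_m}$ is order-isomorphic to $\pi$ and, for every $(a,b)\in R$, there is no index $r$ with $i_a<r<i_{a+1}$ and $v_b<\sigma_r<v_{b+1}$; here $v_1<\cdots<v_m$ is the increasing rearrangement of $\sigma_{i_1},\dots,\sigma_{i_m}$, $i_0=v_0=0$ and $i_{m+1}=v_{m+1}=n+1$. $p(\sigma)$ denotes the number of occurrences of $p$ in $\sigma$. *)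

(* Defs.v *)
From HB Require Import structures.
From mathcomp Require Import all_boot all_fingroup.

Set Implicit Arguments.
Unset Strict Implicit.
Unset Printing Implicit Defensive.

(* A permutation s : 'S_n acts on 'I_n = {0, ..., n-1}.  The one-line notation
   of the corresponding permutation of {1, ..., n} has the entry (s i).+1 at
   position i.+1; all grid coordinates below are these 1-based numbers. *)

Record mesh_pattern (m : nat) := MeshPattern {
  mesh_perm : 'S_m;
  mesh_shading : {set 'I_m.+1 * 'I_m.+1}
}.

Section Occurrences.
Variables (m n : nat).

(* The positions i_0 = 0, i_1, ..., i_m, i_(m+1) = n+1 bounding the columns,
   for the choice of indices i_(a+1) = (f a).+1. *)
Definition mesh_cols (f : {ffun 'I_m -> 'I_n}) : seq nat :=
  0 :: rcons [seq (f a : nat).+1 | a <- enum 'I_m] n.+1.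

(* The values v_0 = 0, v_1 < ... < v_m, v_(m+1) = n+1 bounding the rows. *)
Definition mesh_rows (s : 'S_n) (f : {ffun 'I_m -> 'I_n}) : seq nat :=
  0 :: rcons (sort leq [seq (s (f a) : nat).+1 | a <- enum 'I_m]) n.+1.

Definition in_mesh_cell (s : 'S_n) (f : {ffun 'I_m -> 'I_n}) (a b : nat)
    (r : 'I_n) : bool :=
  (nth 0 (mesh_cols f) a < r.+1 < nth 0 (mesh_cols f) a.+1) &&
  (nth 0 (mesh_rows s f) b < (s r).+1 < nth 0 (mesh_rows s f) b.+1).

Definition mesh_occurrence (p : mesh_pattern m) (s : 'S_n)
    (f : {ffun 'I_m -> 'I_n}) : bool :=
  [&& [forall a : 'I_m, forall b : 'I_m, (a < b) ==> (f a < f b)],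
      [forall a : 'I_m, forall b : 'I_m,
        (s (f a) < s (f b)) == (mesh_perm p a < mesh_perm p b)]
    & [forall c in mesh_shading p, forall r : 'I_n,
        ~~ in_mesh_cell s f c.1 c.2 r]].

Definition mesh_count (p : mesh_pattern m) (s : 'S_n) : nat :=
  #|[set f : {ffun 'I_m -> 'I_n} | mesh_occurrence p s f]|.

End Occurrences.

Definition perm123 : 'S_3 := 1%g.

Definition perm132 : 'S_3 :=
  tperm (@Ordinal 3 1 isT) (@Ordinal 3 2 isT).

Lemma perm123_one_line :
  [seq (perm123 a : nat).+1 | a <- enum 'I_3] = [:: 1; 2; 3].
Proof.
rewrite (eq_map (g := fun a : 'I_3 => a.+1)); last by move=> a; rewrite perm1.
by rewrite (map_comp succn (@nat_of_ord 3)) val_enum_ord.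
Qed.

Lemma perm132_one_line :
  [seq (perm132 a : nat).+1 | a <- enum 'I_3] = [:: 1; 3; 2].
Proof.
rewrite (eq_map (g := fun a : 'I_3 => nth 0 [:: 1; 3; 2] a)).
  by rewrite (map_comp (nth 0 [:: 1; 3; 2]) (@nat_of_ord 3)) val_enum_ord.
by case=> [[|[|[|//]]] i] /=; rewrite /perm132 permE /=.
Qed.

Definition R78 : {set 'I_4 * 'I_4} :=
  [set c : 'I_4 * 'I_4 | (c.1 : nat, c.2 : nat) \in
    [:: (1, 0); (1, 1); (2, 0); (2, 1); (2, 3); (3, 0); (3, 1); (3, 3)]].

Definition P7 : mesh_pattern 3 := MeshPattern perm123 R78.

Definition P8 : mesh_pattern 3 := MeshPattern perm132 R78.

(* Main.v *)
Require Import Defs.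
From mathcomp Require Import all_boot all_fingroup.
From mathcomp Require Import zify.

Set Implicit Arguments.
Unset Strict Implicit.
Unset Printing Implicit Defensive.

(** The shading makes both counts read off from right-to-left extrema.  In an
    occurrence the first entry is followed only by entries that are at least
    the middle value, so the middle value is the least entry to the right of
    the first one; and no entry to the right of the second one exceeds the
    largest value.

    In an occurrence of 123 the second position j therefore carries a
    right-to-left minimum, which is neither the smallest entry of the
    permutation nor its last one.  Conversely such a j determines the
    occurrence: the third position holds the maximum of the entries after j,
    and the first position is the last one before j with an entry below that
    of j.  In an occurrence of 132 the second position j carries a
    right-to-left maximum; then the third position holds the minimum of the
    entries after j, and the first one is the last position before j with an
    entry below this minimum, which exists exactly when the smallest entry of
    the permutation is to the left of j.  Hence the two patterns count the
    right-to-left minima ([mesh_count_P7]) and maxima ([mesh_count_P8]) lying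
    strictly between the smallest entry and the last position.

    Now keep everything up to the smallest entry and reverse the relative
    order of the entries after it, within the set of values that they occupy.
    This map [flip] is an involution, and it exchanges the right-to-left
    minima with the right-to-left maxima of that final segment, so it
    exchanges the two statistics. *)

(** * Occurrences of the two patterns *)

Definition o0 : 'I_3 := @Ordinal 3 0 isT.
Definition o1 : 'I_3 := @Ordinal 3 1 isT.
Definition o2 : 'I_3 := @Ordinal 3 2 isT.

Lemma enum_I3 : enum 'I_3 = [:: o0; o1; o2].
Proof. by apply: (inj_map val_inj); rewrite val_enum_ord. Qed.

Lemma forall_I3 (P : 'I_3 -> Prop) : P o0 -> P o1 -> P o2 -> forall a, P a.
Proof.
move=> P0 P1 P2 [[|[|[|//]]] lt_a].
- by rewrite (_ : Ordinal lt_a = o0) //; apply: val_inj.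
- by rewrite (_ : Ordinal lt_a = o1) //; apply: val_inj.
- by rewrite (_ : Ordinal lt_a = o2) //; apply: val_inj.
Qed.

Lemma perm123E : (perm123 o0 = 0 :> nat) * (perm123 o1 = 1 :> nat) *
  (perm123 o2 = 2 :> nat).
Proof. by rewrite /perm123 !perm1. Qed.

Lemma perm132E : (perm132 o0 = 0 :> nat) * (perm132 o1 = 2 :> nat) *
  (perm132 o2 = 1 :> nat).
Proof. by rewrite /perm132 !permE. Qed.

Section Occurrences.
Variables (n : nat) (s : 'S_n).
Implicit Types (f : {ffun 'I_3 -> 'I_n}) (i j r : 'I_n).

Lemma perm_val_neq i j : i != j -> s i != s j :> nat.
Proof. by move=> ij; rewrite (inj_eq val_inj) (inj_eq perm_inj). Qed.

(** Here [lo] and [hi] are the positions of the middle and of the largest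
    value; leaving open which of them comes first serves both patterns.  The
    shading covers the two bottom rows to the right of the first position and
    the top row to the right of the second one.  The inequalities are weak
    because [r] may be one of the positions of the occurrence itself. *)
Lemma shadingP f lo hi :
    f o0 < f o1 < f o2 -> s (f o0) < s lo < s hi ->
    perm_eq [:: f o1; f o2] [:: lo; hi] ->
  reflect ((forall r, f o0 < r -> s lo <= s r) /\
           (forall r, f o1 < r -> s r <= s hi))
    [forall c in R78, forall r, ~~ in_mesh_cell s f c.1 c.2 r].
Proof.
move=> /andP[f01 f12] /andP[v01 v12] lohi.
have colsE : mesh_cols f = [:: 0; (f o0).+1; (f o1).+1; (f o2).+1; n.+1].
  by rewrite /mesh_cols enum_I3.
have rowsE : mesh_rows s f = [:: 0; (s (f o0)).+1; (s lo).+1; (s hi).+1; n.+1].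
  rewrite /mesh_rows enum_I3; 
  rewrite -[RHS]/(0 :: rcons [:: _; _; _] _); congr (_ :: rcons _ _).
  apply: (sorted_eq leq_trans anti_leq).
  - exact: (sort_sorted leq_total).
  - by rewrite /= !ltnS (ltnW v01) (ltnW v12).
  rewrite perm_sort /= perm_cons.
  exact: (perm_map (fun i : 'I_n => (s i : nat).+1) lohi).
have lohi1 : (f o1 == lo) || (f o1 == hi).
  by have := mem_head (f o1) [:: f o2]; rewrite (perm_mem lohi) !inE.
have lohi2 : (f o2 == lo) || (f o2 == hi).
  have : f o2 \in [:: f o1; f o2] by rewrite !inE eqxx orbT.
  by rewrite (perm_mem lohi) !inE.
have val_in i : (i == lo) || (i == hi) -> s lo <= s i <= s hi.
  by case/orP=> /eqP ->; rewrite leqnn (ltnW v12).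
apply: (iffP idP) => [/'forall_implyP H | [Hlo Hhi]].
  have no_cell a b (lt_a : a < 4) (lt_b : b < 4) r :
      (a, b) \in [:: (1, 0); (1, 1); (2, 0); (2, 1); (2, 3);
                     (3, 0); (3, 1); (3, 3)] ->
      ~~ in_mesh_cell s f a b r.
    move=> ab; have := H (Ordinal lt_a, Ordinal lt_b).
    by rewrite inE => /(_ ab)/forallP/(_ r).
  split=> r ltr; rewrite leqNgt; apply/negP => lt_s.
    have r1 : r != f o1.
      by apply: contraTneq lt_s => ->; rewrite -leqNgt; case/andP: (val_in _ lohi1).
    have r2 : r != f o2.
      by apply: contraTneq lt_s => ->; rewrite -leqNgt; case/andP: (val_in _ lohi2).
    have r0 : s r != s (f o0) :> nat.
      by apply: perm_val_neq; apply: contraTneq ltr => ->; rewrite ltnn.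
    have ltrn := ltn_ord r.
    (* An entry after the first position lies in one of the columns 1 to 3, and
       below [s lo] it lies in row 0 or 1; these six cells are shaded. *)
    have [a [lt_a a0 Ha]] : exists a, [/\ a < 4, 0 < a &
        nth 0 (mesh_cols f) a < r.+1 < nth 0 (mesh_cols f) a.+1].
      rewrite colsE; case: (ltngtP r (f o1)) => [?||/val_inj E].
      - by exists 1; split=> //=; lia.
      - case: (ltngtP r (f o2)) => [?|?|/val_inj E] ?.
        + by exists 2; split=> //=; lia.
        + by exists 3; split=> //=; lia.
        + by rewrite E eqxx in r2.
      - by rewrite E eqxx in r1.
    have [b [lt_b Hb]] : exists b, b < 2 /\
        nth 0 (mesh_rows s f) b < (s r).+1 < nth 0 (mesh_rows s f) b.+1.
      rewrite rowsE; case: (ltngtP (s r) (s (f o0))) => [?|?|E].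
      - by exists 0; split=> //=; lia.
      - by exists 1; split=> //=; lia.
      - by rewrite E eqxx in r0.
    have lt_b4 : b < 4 by lia.
    have := no_cell a b lt_a lt_b4 r; rewrite /in_mesh_cell Ha Hb.
    by case: (a) a0 lt_a => [|[|[|[|]]]] //; case: (b) lt_b => [|[|]] //= _ _ _ /(_ isT).
  (* An entry above [s hi] after the second position lies in row 3 of column 2
     or 3. *)
  have r2 : r != f o2.
    by apply: contraTneq lt_s => ->; rewrite -leqNgt; case/andP: (val_in _ lohi2).
  have ltrn := ltn_ord r; have ltsn := ltn_ord (s r).
  case: (ltngtP r (f o2)) => [?|?|/val_inj E]; last by rewrite E eqxx in r2.
    have /negP[] := no_cell 2 3 isT isT r isT.
    by rewrite /in_mesh_cell colsE rowsE /=; lia.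
  have /negP[] := no_cell 3 3 isT isT r isT.
  by rewrite /in_mesh_cell colsE rowsE /=; lia.
apply/'forall_implyP => -[a b]; rewrite inE => ab.
apply/forallP => r; move: ab; rewrite /in_mesh_cell !inE !xpair_eqE.
have Hl := Hlo r; have Hh := Hhi r.
do 7?[case/orP]; case/andP=> /eqP -> /eqP ->; rewrite colsE rowsE /=;
  apply/negP; lia.
Qed.

Lemma occP7 f :
  reflect [/\ f o0 < f o1 < f o2, s (f o0) < s (f o1),
              forall r, f o0 < r -> s (f o1) <= s r &
              forall r, f o1 < r -> s r <= s (f o2)]
    (mesh_occurrence P7 s f).
Proof.
apply: (iffP and3P) => [[/forallP Hf /forallP Hs sh] | [H012 Hv Hlo Hhi]].
  have f01 : f o0 < f o1 by have /forallP/(_ o1) := Hf o0.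
  have f12 : f o1 < f o2 by have /forallP/(_ o2) := Hf o1.
  have v01 : s (f o0) < s (f o1).
    by have /forallP/(_ o1)/eqP -> := Hs o0; rewrite /= !perm123E.
  have v12 : s (f o1) < s (f o2).
    by have /forallP/(_ o2)/eqP -> := Hs o1; rewrite /= !perm123E.
  have H012 : f o0 < f o1 < f o2 by rewrite f01.
  by case: (@shadingP f (f o1) (f o2) H012 _ (perm_refl _)) sh; rewrite ?v01 // => -[].
have [f01 f12] := andP H012.
have v12 : s (f o1) < s (f o2).
  rewrite ltn_neqAle Hlo ?(ltn_trans f01) // andbT perm_val_neq //.
  by rewrite -(inj_eq val_inj) neq_ltn f12.
split.
- have f02 := ltn_trans f01 f12.
  apply/forallP; elim/forall_I3; apply/forallP; elim/forall_I3;
    by rewrite /= ?f01 ?f02 ?f12.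
- apply/forallP; elim/forall_I3; apply/forallP; elim/forall_I3;
    by rewrite /= !perm123E /= ?ltnn; apply/eqP; lia.
- by apply/(@shadingP f (f o1) (f o2) H012 _ (perm_refl _)); rewrite ?Hv.
Qed.

Lemma occP8 f :
  reflect [/\ f o0 < f o1 < f o2, s (f o0) < s (f o2),
              forall r, f o0 < r -> s (f o2) <= s r &
              forall r, f o1 < r -> s r <= s (f o1)]
    (mesh_occurrence P8 s f).
Proof.
have perm21 : perm_eq [:: f o1; f o2] [:: f o2; f o1].
  by rewrite (perm_catC [:: _] [:: _]).
apply: (iffP and3P) => [[/forallP Hf /forallP Hs sh] | [H012 Hv Hlo Hhi]].
  have f01 : f o0 < f o1 by have /forallP/(_ o1) := Hf o0.
  have f12 : f o1 < f o2 by have /forallP/(_ o2) := Hf o1.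
  have v01 : s (f o0) < s (f o2).
    by have /forallP/(_ o2)/eqP -> := Hs o0; rewrite /= !perm132E.
  have v12 : s (f o2) < s (f o1).
    by have /forallP/(_ o1)/eqP -> := Hs o2; rewrite /= !perm132E.
  have H012 : f o0 < f o1 < f o2 by rewrite f01.
  by case: (@shadingP f (f o2) (f o1) H012 _ perm21) sh; rewrite ?v01 // => -[].
have [f01 f12] := andP H012.
have v12 : s (f o2) < s (f o1).
  rewrite ltn_neqAle Hlo // andbT perm_val_neq //.
  by rewrite -(inj_eq val_inj) neq_ltn f12 orbT.
split.
- have f02 := ltn_trans f01 f12.
  apply/forallP; elim/forall_I3; apply/forallP; elim/forall_I3;
    by rewrite /= ?f01 ?f02 ?f12.
- apply/forallP; elim/forall_I3; apply/forallP; elim/forall_I3;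
    by rewrite /= !perm132E /= ?ltnn; apply/eqP; lia.
- by apply/(@shadingP f (f o2) (f o1) H012 _ perm21); rewrite ?Hv.
Qed.

End Occurrences.

(** * Counting occurrences by right-to-left extrema *)

Section Between.
Variable n : nat.
Implicit Types (s : 'S_n.+1) (f : {ffun 'I_3 -> 'I_n.+1}) (i j r : 'I_n.+1).

Definition pos0 s : 'I_n.+1 := (s^-1)%g ord0.

Lemma pos0E s : s (pos0 s) = ord0.
Proof. exact: permKV. Qed.

Definition rlmin_between s : {set 'I_n.+1} :=
  [set j : 'I_n.+1 | (pos0 s < j < n) && [forall r : 'I_n.+1, (j < r) ==> (s j < s r)]].

Definition rlmax_between s : {set 'I_n.+1} :=
  [set j : 'I_n.+1 | (pos0 s < j < n) && [forall r : 'I_n.+1, (j < r) ==> (s r < s j)]].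

Lemma rlmin_betweenP s j :
  reflect (pos0 s < j < n /\ forall r, j < r -> s j < s r)
          (j \in rlmin_between s).
Proof. by rewrite inE; apply: (iffP andP) => -[-> /'forall_implyP]. Qed.

Lemma rlmax_betweenP s j :
  reflect (pos0 s < j < n /\ forall r, j < r -> s r < s j)
          (j \in rlmax_between s).
Proof. by rewrite inE; apply: (iffP andP) => -[-> /'forall_implyP]. Qed.

Lemma val_pos0_lt s j : pos0 s != j -> 0 < s j.
Proof.
move=> neq; rewrite lt0n; apply: contraNneq neq => sj0.
by apply/eqP/(@perm_inj _ s)/val_inj; rewrite pos0E.
Qed.

(** This finds the first position of an occurrence: being the last one with an
    entry below [v], it leaves only entries at least [v] up to [j].  The
    smallest entry guarantees that there is one. *)
Lemma last_below s j v : pos0 s < j -> 0 < v ->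
  exists2 i : 'I_n.+1, i < j /\ s i < v & forall r : 'I_n.+1, i < r < j -> v <= s r.
Proof.
move=> ltj v0; pose P (i : 'I_n.+1) := (i < j) && (s i < v).
have P0 : P (pos0 s) by rewrite /P ltj pos0E.
case: (@arg_maxnP _ (pos0 s) P (fun i => i) P0) => i /andP[ij iv] maxi.
exists i => // r /andP[ir rj]; rewrite leqNgt; apply/negP => rv.
by have := maxi r; rewrite /P rj rv /= leqNgt ir => /(_ isT).
Qed.

Lemma ffun3_eq (f g : {ffun 'I_3 -> 'I_n.+1}) : f o0 = g o0 -> f o1 = g o1 -> f o2 = g o2 -> f = g.
Proof. by move=> *; apply/ffunP; elim/forall_I3. Qed.

(** The bijection sends an occurrence to its second position.  It is injective
    because two different first positions would put a too small entry after
    the leftmost of them, and the largest value is the maximum after the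
    second position. *)
Lemma mesh_count_P7 s : mesh_count P7 s = #|rlmin_between s|.
Proof.
pose mid (f : {ffun 'I_3 -> 'I_n.+1}) := f o1.
have mid_inj : {in [set f | mesh_occurrence P7 s f] &, injective mid}.
  move=> f g; rewrite !inE => /occP7[/andP[f01 f12] fv flo fhi].
  move=> /occP7[/andP[g01 g12] gv glo ghi] fg1; rewrite /mid in fg1.
  apply: ffun3_eq => //.
    apply/val_inj/eqP; case: ltngtP => // lt0.
      by have := flo _ lt0; rewrite fg1 leqNgt gv.
    by have := glo _ lt0; rewrite -fg1 leqNgt fv.
  apply/(@perm_inj _ s)/val_inj/eqP.
  by rewrite eqn_leq fhi ?ghi // ?fg1 // -fg1.
rewrite /mesh_count -(card_in_imset mid_inj); apply: eq_card => j.
apply/imsetP/rlmin_betweenP.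
  case=> f; rewrite inE => /occP7[/andP[f01 f12] fv flo fhi] ->.
  split=> [|r ltr]; last first.
    rewrite ltn_neqAle flo ?(ltn_trans f01) // andbT perm_val_neq //.
    by rewrite -(inj_eq val_inj) neq_ltn ltr.
  rewrite (leq_trans f12) ?andbT; last by rewrite -ltnS.
  rewrite ltnNge; apply/negP => le1.
  by have := flo _ (leq_trans f01 le1); rewrite pos0E leqNgt (leq_ltn_trans _ fv).
case=> /andP[ltj jn] minj.
have sj0 : 0 < s j by apply: val_pos0_lt; rewrite -(inj_eq val_inj) neq_ltn ltj.
have [i [ij ivj] ilo] := last_below ltj sj0.
case: (@arg_maxnP _ ord_max (fun r : 'I_n.+1 => j < r) (fun r => s r) jn) => m jm maxm.
exists [ffun a : 'I_3 => nth i [:: i; j; m] a]; last by rewrite /mid ffunE.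
rewrite inE; apply/occP7; rewrite !ffunE /=; split=> [||r ir|r jr].
- by rewrite ij.
- by [].
- case: (ltngtP r j) => [rj|jr|/val_inj ->] //; first by rewrite ilo // ir.
  by rewrite ltnW ?minj.
- exact: maxm.
Qed.

(** As for 123, with the roles of the last two values exchanged: the second
    position carries the largest value, and the third one the minimum of the
    entries after it. *)
Lemma mesh_count_P8 s : mesh_count P8 s = #|rlmax_between s|.
Proof.
pose mid (f : {ffun 'I_3 -> 'I_n.+1}) := f o1.
have mid_inj : {in [set f | mesh_occurrence P8 s f] &, injective mid}.
  move=> f g; rewrite !inE => /occP8[/andP[f01 f12] fv flo fhi].
  move=> /occP8[/andP[g01 g12] gv glo ghi] fg1; rewrite /mid in fg1.
  have fg2 : f o2 = g o2.
    apply/(@perm_inj _ s)/val_inj/eqP.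
    by rewrite eqn_leq flo ?glo // ?(ltn_trans g01) -?fg1 // (ltn_trans f01) ?fg1.
  apply: ffun3_eq => //; apply/val_inj/eqP; case: ltngtP => // lt0.
    by have := flo _ lt0; rewrite fg2 leqNgt gv.
  by have := glo _ lt0; rewrite -fg2 leqNgt fv.
rewrite /mesh_count -(card_in_imset mid_inj); apply: eq_card => j.
apply/imsetP/rlmax_betweenP.
  case=> f; rewrite inE => /occP8[/andP[f01 f12] fv flo fhi] ->.
  split=> [|r ltr]; last first.
    rewrite ltn_neqAle fhi // andbT perm_val_neq //.
    by rewrite -(inj_eq val_inj) neq_ltn ltr orbT.
  rewrite (leq_trans f12) ?andbT; last by rewrite -ltnS.
  rewrite ltnNge; apply/negP => le1.
  by have := flo _ (leq_trans f01 le1); rewrite pos0E leqNgt (leq_ltn_trans _ fv).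
case=> /andP[ltj jn] maxj.
case: (@arg_minnP _ ord_max (fun r : 'I_n.+1 => j < r) (fun r => s r) jn) => m jm minm.
have sm0 : 0 < s m.
  by apply: val_pos0_lt; rewrite -(inj_eq val_inj) neq_ltn (ltn_trans ltj).
have [i [ij ivm] ilo] := last_below ltj sm0.
exists [ffun a : 'I_3 => nth i [:: i; j; m] a]; last by rewrite /mid ffunE.
rewrite inE; apply/occP8; rewrite !ffunE /=; split=> [||r ir|r jr].
- by rewrite ij.
- by [].
- case: (ltngtP r j) => [rj|jr|/val_inj ->]; first by rewrite ilo // ir.
    exact: minm.
  by rewrite ltnW ?maxj.
- by rewrite ltnW ?maxj.
Qed.

End Between.

(** * Reversing the order on a set of values *)

Section ReverseIn.
Variables (n : nat) (S : {set 'I_n}).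
Implicit Types u v : 'I_n.

(** The default value of [nth] is [v], so that elements outside [S], whose
    index is the size of the enumeration, are fixed. *)
Definition reverse_in v := nth v (rev (enum S)) (index v (enum S)).

Lemma reverse_in_out v : v \notin S -> reverse_in v = v.
Proof. by move=> vS; rewrite /reverse_in nth_default // size_rev memNindex ?mem_enum. Qed.

Lemma reverse_in_mem v : v \in S -> reverse_in v \in S.
Proof.
move=> vS; rewrite -mem_enum -mem_rev mem_nth // size_rev index_mem.
by rewrite mem_enum.
Qed.

Lemma reverse_inE v0 v : v \in S ->
  reverse_in v = nth v0 (enum S) (size (enum S) - (index v (enum S)).+1).
Proof.
rewrite -mem_enum -index_mem => lt_v; rewrite /reverse_in nth_rev //.
by apply: set_nth_default; rewrite ltn_subrL (leq_ltn_trans _ lt_v).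
Qed.

Lemma index_reverse_in v : v \in S ->
  index (reverse_in v) (enum S) = size (enum S) - (index v (enum S)).+1.
Proof.
move=> vS; have lt_v : index v (enum S) < size (enum S).
  by rewrite index_mem mem_enum.
by rewrite (reverse_inE v) // index_uniq ?enum_uniq // ltn_subrL (leq_ltn_trans _ lt_v).
Qed.

Lemma reverse_inK : involutive reverse_in.
Proof.
move=> v; have [vS | vS] := boolP (v \in S); last by rewrite !reverse_in_out.
rewrite (reverse_inE v) ?reverse_in_mem // index_reverse_in //.
rewrite subnSK ?subKn ?nth_index ?mem_enum //.
  by rewrite ltnW // index_mem mem_enum.
by rewrite index_mem mem_enum.
Qed.

Lemma reverse_in_imset : reverse_in @: S = S.
Proof.
apply/eqP; rewrite eqEcard card_imset ?leqnn ?andbT; last exact: inv_inj reverse_inK.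
by apply/subsetP => _ /imsetP[v vS ->]; apply: reverse_in_mem.
Qed.

Lemma enum_sorted : sorted (relpre val ltn) (enum S).
Proof.
rewrite /enum_mem sorted_filter //; first by move=> ? ? ?; apply: ltn_trans.
by rewrite -sorted_map -enumT val_enum_ord iota_ltn_sorted.
Qed.

Lemma index_enum_mono : {in S &, {mono index^~ (enum S) : u v / u < v}}.
Proof.
have tr : transitive (relpre val ltn : rel 'I_n) by move=> ? ? ?; apply: ltn_trans.
have lt u v : u \in S -> v \in S -> index u (enum S) < index v (enum S) -> u < v.
  by move=> uS vS; apply: (sorted_ltn_index tr enum_sorted); rewrite mem_enum.
move=> u v uS vS /=; case: (ltngtP (index u _)) => [/lt->|/lt lt_vu|/index_inj->] //.
- by rewrite ltnNge ltnW ?lt_vu.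
- by rewrite ltnn.
- by rewrite mem_enum.
- by rewrite mem_enum.
Qed.

Lemma reverse_in_anti u v : u \in S -> v \in S ->
  (reverse_in u < reverse_in v) = (v < u).
Proof.
move=> uS vS; rewrite -index_enum_mono ?reverse_in_mem // !index_reverse_in //.
rewrite -(index_enum_mono vS uS) /= ltn_sub2lE ?ltnS //.
by rewrite index_mem mem_enum.
Qed.

End ReverseIn.

(** * The involution *)

Section Flip.
Variable n : nat.
Implicit Types (s : 'S_n.+1) (j r : 'I_n.+1).

Definition tail_values s : {set 'I_n.+1} := [set s j | j : 'I_n.+1 & pos0 s < j].

Definition flip s : 'S_n.+1 :=
  (s * perm (inv_inj (reverse_inK (tail_values s))))%g.

Lemma flipE s j : flip s j = reverse_in (tail_values s) (s j).
Proof. by rewrite permM permE. Qed.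

Lemma mem_tail_values s j : (s j \in tail_values s) = (pos0 s < j).
Proof. by rewrite mem_imset ?inE //; apply: perm_inj. Qed.

Lemma pos0_flip s : pos0 (flip s) = pos0 s.
Proof.
apply: (@perm_inj _ (flip s)); rewrite pos0E flipE reverse_in_out ?pos0E //.
by rewrite -(pos0E s) mem_tail_values ltnn.
Qed.

(** [flip] reverses within the same set of values when applied again, which is
    what makes it an involution. *)
Lemma tail_values_flip s : tail_values (flip s) = tail_values s.
Proof.
rewrite -[RHS]reverse_in_imset -imset_comp /tail_values pos0_flip.
by apply: eq_imset => j; rewrite flipE.
Qed.

Lemma flipK : involutive flip.
Proof.
by move=> s; apply/permP => j; rewrite !flipE tail_values_flip reverse_inK.
Qed.

Lemma flip_anti s j r : pos0 s < j -> pos0 s < r ->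
  (flip s j < flip s r) = (s r < s j).
Proof. by move=> ltj ltr; rewrite !flipE reverse_in_anti ?mem_tail_values. Qed.

(** Being extremal is a comparison with later entries only, and these all lie
    in the segment on which [flip] reverses the order. *)
Lemma rlmin_between_flip s : rlmin_between (flip s) = rlmax_between s.
Proof.
apply/setP => j; rewrite !inE pos0_flip.
case: (ltnP (pos0 s) j) => //= ltj; congr (_ && _); apply: eq_forallb => r.
by case: (ltnP j r) => //= jr; rewrite flip_anti // (ltn_trans ltj).
Qed.

Lemma mesh_count_P7_flip s : mesh_count P7 (flip s) = mesh_count P8 s.
Proof. by rewrite mesh_count_P7 mesh_count_P8 rlmin_between_flip. Qed.

Lemma mesh_count_P8_flip s : mesh_count P8 (flip s) = mesh_count P7 s.
Proof. by rewrite -[in RHS](flipK s) mesh_count_P7_flip. Qed.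

End Flip.

Theorem mainTheorem4 (n k l : nat) (hn : 1 <= n) :
  #|[set s : 'S_n | (mesh_count P7 s == k) && (mesh_count P8 s == l)]| =
  #|[set s : 'S_n | (mesh_count P8 s == k) && (mesh_count P7 s == l)]|.
Proof.
case: n hn => // n _.
rewrite -(card_preimset _ (inv_inj (@flipK n))); apply: eq_card => s.
by rewrite !inE mesh_count_P7_flip mesh_count_P8_flip.
Qed.
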